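(* Let $s\geq 2$ be an integer. For every positive integer $j$, there exist an integer $m$ and a balanced bipartite graph $G[U,V]$ on $2n=2ms$ vertices such that $\delta_U+\delta_V=n+3s-7$ and $2sj-s-1\leq |\delta_V-\delta_U|\leq 2sj-1$, but $G$ cannot be tiled with $K_{s,s}$.
   Context: $G[U,V]$ denotes a bipartite graph with vertex classes (parts) $U$ and $V$; it is balanced if $|U|=|V|$. For such a graph, $\delta_U:=\min\{\deg(u):u\in U\}$ and $\delta_V:=\min\{\deg(v):v\in V\}$. A balanced bipartite graph $G$ on $2ms$ vertices can be tiled with $K_{s,s}$ if $G$ contains $m$ pairwise vertex-disjoint copies of the complete bipartite graph $K_{s,s}$ as (not necessarily induced) subgraphs, i.e. copies covering all vertices of $G$. *)

(* Defs.v *)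
From mathcomp Require Import all_boot all_order all_algebra.

Set Implicit Arguments.
Unset Strict Implicit.
Unset Printing Implicit Defensive.

Section Graphs.
Variables (T : finType) (e : rel T).
Implicit Types A B U V : {set T}.

Definition simple_graph := symmetric e /\ irreflexive e.

Definition bipartition U V :=
  [/\ U :|: V = [set: T], [disjoint U & V] &
      forall x y, e x y ->
        (x \in U) && (y \in V) || (x \in V) && (y \in U)].

Definition balanced_bipartite U V :=
  [/\ simple_graph, bipartition U V & #|U| = #|V|].

Definition deg (x : T) : nat := #|[set y | e x y]|.

(* The default #|T| bounds every degree, so this is the true minimum
   whenever U is nonempty. *)
Definition min_deg U : nat := \big[minn/#|T|]_(u in U) deg u.

(* A not necessarily induced copy of K_{s,s} with classes A and B. *)
Definition Kss_copy (s : nat) A B :=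
  [/\ #|A| = s, #|B| = s, [disjoint A & B] & {in A & B, forall x y, e x y}].

(* On a graph with 2ms vertices, m disjoint copies cover all the vertices. *)
Definition Kss_tiling (s m : nat) :=
  exists A B : 'I_m -> {set T},
    (forall i, Kss_copy s (A i) (B i)) /\
    (forall i k, i != k -> [disjoint A i :|: B i & A k :|: B k]).

End Graphs.

(* Main.v *)
Require Import Defs.
From mathcomp Require Import all_boot all_order all_algebra.
From mathcomp Require Import zify.
Import Order.TTheory GRing.Theory Num.Theory.

Set Implicit Arguments.
Unset Strict Implicit.
Unset Printing Implicit Defensive.

Local Open Scope ring_scope.

(** Split U into U0 and U1, and V into V0 and V1, make the pairs (U0, V1) and
    (U1, V0) complete, and put sparse graphs H0 between U0 and V0 and H1 between
    V1 and U1.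

    The obstruction to a tiling ([no_Kss_tiling]): if H0 has maximum degree at
    most s - 2 and H1 contains no 4-cycle, then no copy of K_{s,s} meets both U0
    and V0.  For if it does, the degree bound in H0 leaves at least two of its
    vertices in each of U1 and V1, and these span a 4-cycle of H1.  So in a tiling
    the k tiles that meet U0 cover U0 and have their other classes inside V1,
    whence |U0| <= ks <= |V1|.  This is impossible when |U0| = 1 + w and
    |V1| = s - 1 + w with w a multiple of s.

    The degrees: put D = 2js, |V0| = w + 1 + D and |U1| = w + s - 1 + D, so that
    n = 2w + s + D.
    - If every vertex of U0 has H0-degree s - 2, the vertices of U0 have degree
      w + 2s - 3, and those of U1, joined to all of V0, have more.
    - The vertices of V0 have H0-degree at least s - 3, hence degree at least
      w + D + 2s - 4.  As |V0| > |U0|, they cannot all have H0-degree s - 2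
      when s > 2.
    - If every vertex of V1 has H1-degree D + 2s - 5, it has degree exactly
      w + D + 2s - 4.
    So the minimum degrees are w + 2s - 3 and w + D + 2s - 4.  Their sum is
    n + 3s - 7 and their difference is D - 1 = 2sj - 1.

    Both sparse graphs join x to x + c modulo the size of the larger side, for c
    in a fixed set of shifts.  For H0 the shifts are the multiples of D, so that
    the gaps left by the different translates of the smaller side are disjoint
    and each vertex of V0 loses at most one neighbour
    ([near_regular_bipartite]).  For H1 the shifts are powers of 2, which form a
    Sidon set, so that there is no 4-cycle ([C4_free_bipartite]).  Both need w to
    be large. *)

(** * The obstruction to a tiling *)

Section Obstruction.
Local Open Scope nat_scope.
Variables (T : finType) (e : rel T) (U V : {set T}).
Hypotheses (e_sym : symmetric e) (bipUV : bipartition e U V).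

Lemma bipartition_nbr_in x y : e x y -> x \in U -> y \in V.
Proof.
case: bipUV => _ dUV edge exy xU.
case/orP: (edge _ _ exy) => /andP[] // xV.
by rewrite (disjointFr dUV xU) in xV.
Qed.

Lemma bipartition_nbr_notin x y : e x y -> x \notin U -> y \in U /\ x \in V.
Proof.
case: bipUV => _ _ edge exy xU.
by case/orP: (edge _ _ exy) => /andP[]; rewrite ?(negPf xU).
Qed.

(** The classes A and B of a copy may lie either way round in U and V; this form
    fixes the orientation for all tiles at once. *)
Lemma Kss_copy_orient s A B : 0 < s -> Kss_copy e s A B ->
  Kss_copy e s ((A :|: B) :&: U) ((A :|: B) :&: V).
Proof.
move=> s_gt0.
have [_ dUV _] := bipUV.
have oriented C D : Kss_copy e s C D -> (exists2 x, x \in C & x \in U) ->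
    Kss_copy e s ((C :|: D) :&: U) ((C :|: D) :&: V).
  move=> [cC cD dCD eCD] [x xC xU].
  have DV y : y \in D -> y \in V.
    by move=> yD; apply: (bipartition_nbr_in (eCD _ _ xC yD)).
  have [y yD] : exists y, y \in D by apply/card_gt0P; rewrite cD.
  have CU z : z \in C -> z \in U.
    move=> zC; apply/idPn => /(bipartition_nbr_notin (eCD _ _ zC yD)) [yU _].
    by have := DV _ yD; rewrite (disjointFr dUV yU).
  have -> : (C :|: D) :&: U = C.
    apply/setP=> z; rewrite !inE; case zC: (z \in C); first by rewrite CU.
    by case zD: (z \in D); rewrite //= (disjointFl dUV (DV _ zD)).
  have -> : (C :|: D) :&: V = D.
    apply/setP=> z; rewrite !inE orbC; case zD: (z \in D); first by rewrite DV.
    by case zC: (z \in C); rewrite //= (disjointFr dUV (CU _ zC)).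
  by split.
move=> copyAB; have [cA cB dAB eAB] := copyAB.
have [x xA] : exists x, x \in A by apply/card_gt0P; rewrite cA.
have [y yB] : exists y, y \in B by apply/card_gt0P; rewrite cB.
case xU: (x \in U); first by apply: oriented => //; exists x.
have [yU _] := bipartition_nbr_notin (eAB _ _ xA yB) (negbT xU).
rewrite setUC; apply: oriented; last by exists y.
by split=> //; [rewrite disjoint_sym | move=> u v uB vA; rewrite e_sym eAB].
Qed.

Variables (U0 V0 : {set T}) (s : nat).
Hypotheses (s_gt0 : 0 < s)
  (degU0 : {in U0, forall u, #|[set v in V0 | e u v]| + 2 <= s})
  (degV0 : {in V0, forall v, #|[set u in U0 | e u v]| + 2 <= s})
  (C4_free : forall x x' y y',
     x \in U :\: U0 -> x' \in U :\: U0 -> y \in V :\: V0 -> y' \in V :\: V0 ->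
     e x y -> e x y' -> e x' y -> e x' y' -> x = x' \/ y = y').

(** A tile meeting both U0 and V0 would keep two vertices on each side outside
    them, by the degree bounds, and these would form a 4-cycle. *)
Lemma Kss_copy_avoids (A B : {set T}) : A \subset U -> B \subset V ->
  Kss_copy e s A B -> [disjoint A & U0] \/ [disjoint B & V0].
Proof.
move=> AU BV [cA cB _ eAB].
have [|[u /setIP[uA uU0]]] := set_0Vmem (A :&: U0).
  by move/eqP; rewrite setI_eq0; left.
have [|[v /setIP[vB vV0]]] := set_0Vmem (B :&: V0).
  by move/eqP; rewrite setI_eq0; right.
have le2 (C D N : {set T}) : #|C| = s -> #|N| + 2 <= s -> C :&: D \subset N ->
    1 < #|C :\: D|.
  move=> cC cN /subset_leq_card; have := cardsID D C; lia.
have /card_gt1P[y [y' [/setDP[yB yV0] /setDP[yB' yV0'] yy']]] : 1 < #|B :\: V0|.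
  apply: (le2 _ _ _ cB (degU0 uU0)); apply/subsetP=> z /setIP[zB zV0].
  by rewrite inE zV0 eAB.
have /card_gt1P[x [x' [/setDP[xA xU0] /setDP[xA' xU0'] xx']]] : 1 < #|A :\: U0|.
  apply: (le2 _ _ _ cA (degV0 vV0)); apply/subsetP=> z /setIP[zA zU0].
  by rewrite inE zU0 eAB.
have inU z : z \in A -> z \notin U0 -> z \in U :\: U0.
  by move=> zA zU0; rewrite inE zU0 (subsetP AU).
have inV z : z \in B -> z \notin V0 -> z \in V :\: V0.
  by move=> zB zV0; rewrite inE zV0 (subsetP BV).
have [] : x = x' \/ y = y' by apply: C4_free; rewrite ?inU ?inV ?eAB.
  by move/eqP; rewrite (negPf xx').
by move/eqP; rewrite (negPf yy').
Qed.

(** The multiple of s that cannot exist is s times the number of tiles that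
    meet U0: these tiles cover U0, and their V-classes are disjoint subsets of
    V :\: V0. *)
Lemma no_Kss_tiling m : U0 \subset U -> #|U| = m * s ->
  (forall k, ~~ (#|U0| <= k * s <= #|V :\: V0|)) -> ~ Kss_tiling e s m.
Proof.
move=> U0U cU no_multiple [A [B [copyAB disjAB]]].
pose A' i := (A i :|: B i) :&: U; pose B' i := (A i :|: B i) :&: V.
have copy' i : Kss_copy e s (A' i) (B' i) by apply: Kss_copy_orient.
have disj' (W : {set T}) i k : i != k ->
    [disjoint (A i :|: B i) :&: W & (A k :|: B k) :&: W].
  move=> /disjAB; rewrite -!setI_eq0 => /eqP ik0.
  by rewrite setIACA ik0 set0I.
have sum_card (F : 'I_m -> {set T}) :
    (forall i k, i != k -> [disjoint F i & F k]) ->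
    #|\bigcup_i F i| = \sum_i #|F i|.
  move=> dF; rewrite -sum1_card partition_disjoint_bigcup //.
  by apply: eq_bigr => i _; rewrite sum1_card.
have coverU : \bigcup_i A' i = U.
  apply/eqP; rewrite eqEcard; apply/andP; split.
    by apply/bigcupsP => i _; rewrite subsetIr.
  rewrite sum_card; last by move=> i k; apply: disj'.
  rewrite cU (eq_bigr (fun=> s)); first by rewrite sum_nat_const card_ord.
  by move=> i _; case: (copy' i).
pose K := [set i | ~~ [disjoint A' i & U0]].
have /negP[] := no_multiple #|K|; apply/andP; split.
  have sub : U0 \subset \bigcup_(i in K) A' i.
    apply/subsetP=> x xU0.
    have /bigcupP[i _ xA] : x \in \bigcup_i A' i by rewrite coverU (subsetP U0U).
    apply/bigcupP; exists i => //; rewrite inE.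
    by apply/negP => /disjointFr/(_ xA); rewrite xU0.
  apply: leq_trans (subset_leq_card sub) _.
  apply: leq_trans (_ : \sum_(i in K) #|A' i| <= _).
    elim/big_rec2: _ => [|i n C _ le_n]; first by rewrite cards0.
    by apply: leq_trans (leq_card_setU _ _) _; rewrite leq_add2l.
  rewrite (eq_bigr (fun=> s)); first by rewrite sum_nat_const.
  by move=> i _; case: (copy' i).
pose F i := if i \in K then B' i else set0.
have dF i k : i != k -> [disjoint F i & F k].
  move=> ik; rewrite /F; case: ifP; last by rewrite -setI_eq0 set0I.
  case: ifP => _ _; first exact: disj'.
  by rewrite -setI_eq0 setI0.
have -> : #|K| * s = #|\bigcup_i F i|.
  rewrite sum_card // -sum_nat_const big_mkcond; apply: eq_bigr => i _.
  by rewrite /F; case: ifP; rewrite ?cards0 //; case: (copy' i).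
apply/subset_leq_card/bigcupsP => i _; rewrite /F; case: ifP => [|_].
  have [A0|B0] := Kss_copy_avoids (subsetIr _ _) (subsetIr _ _) (copy' i).
    by rewrite inE A0.
  by move=> _; rewrite setDE subsetI subsetIr -disjoints_subset.
exact: sub0set.
Qed.

End Obstruction.

(** * Sparse bipartite graphs from cyclic shifts *)

Section DifferenceGraph.
Variables (G : finZmodType) (I : finType) (f : I -> G) (C : {set G}).
Hypothesis f_inj : injective f.

(** A bipartite Cayley graph of G with connection set C, one side of which is
    restricted to the image of f. *)
Definition diff_adj x y := y - f x \in C.

Lemma card_diff_adjr x : #|[set y | diff_adj x y]| = #|C|.
Proof.
rewrite -(card_imset _ (addIr (f x))); apply: eq_card => y; rewrite inE.
apply/idP/imsetP=> [yC | [c cC ->]]; last by rewrite /diff_adj addrK.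
by exists (y - f x); rewrite ?subrK.
Qed.

Lemma diff_adjl_imset y :
  [set y - f x | x in [set x | diff_adj x y]] = [set c in C | y - c \in codom f].
Proof.
apply/setP=> c; rewrite inE; apply/imsetP/andP => [[x] | [cC /codomP[x yc]]].
  by rewrite inE /diff_adj => xC ->; rewrite subKr codom_f.
by exists x; rewrite ?inE /diff_adj -yc subKr.
Qed.

Lemma card_diff_adjl y :
  #|[set x | diff_adj x y]| = #|[set c in C | y - c \in codom f]|.
Proof.
by rewrite -diff_adjl_imset card_imset // => x x' /addrI/oppr_inj/f_inj.
Qed.

Lemma card_diff_adjl_le y : (#|[set x | diff_adj x y]| <= #|C|)%N.
Proof.
by rewrite card_diff_adjl; apply/subset_leq_card/subsetP => c; rewrite inE => /andP[].
Qed.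

(** An element y loses the neighbour y - c exactly when y - c falls outside the
    image of f; the hypothesis says that this happens for at most one c. *)
Lemma card_diff_adjl_ge y :
    {in C &, forall c c', y - c \notin codom f -> y - c' \notin codom f -> c = c'} ->
  (#|C| <= #|[set x | diff_adj x y]| + 1)%N.
Proof.
move=> miss1; rewrite card_diff_adjl -(cardsID [set c | y - c \in codom f] C).
rewrite -setIdE leq_add2l; apply/card_le1_eqP => c c'.
rewrite !inE => /andP[mc cC] /andP[mc' cC']; exact: miss1.
Qed.

(** Going round a 4-cycle gives an additive relation c1 + c4 = c2 + c3 in C, and
    the Sidon property only allows the degenerate ones. *)
Lemma diff_adj_C4_free :
    {in C & C, forall c1 c2, {in C & C, forall c3 c4,
       c1 + c4 = c2 + c3 -> c1 = c2 \/ c1 = c3}} ->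
  forall x x' y y', diff_adj x y -> diff_adj x y' -> diff_adj x' y ->
    diff_adj x' y' -> x = x' \/ y = y'.
Proof.
move=> sidon x x' y y' c1 c2 c3 c4.
have [| /addIr -> | /addrI/oppr_inj/f_inj ->] := sidon _ _ c1 c2 _ _ c3 c4.
- by rewrite addrACA [RHS]addrACA [- f x + _]addrC [y' + y]addrC [in RHS]addrC
    [in LHS]addrC [- f x' - f x]addrC.
- by right.
- by left.
Qed.

End DifferenceGraph.

(** Join x to x + iD modulo N + D, for i < d.  The i-th translate of [0, N) misses
    exactly the D residues N + iD + r with r < D, and as dD <= N + D these gaps
    are disjoint for different i. *)
Lemma near_regular_bipartite d D N : (0 < D)%N -> (d * D <= N + D)%N ->
  exists h : 'I_N -> 'I_(N + D) -> bool,
    (forall x, #|[set y | h x y]| = d) /\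
    (forall y, #|[set x | h x y]| <= d <= #|[set x | h x y]| + 1)%N.
Proof.
move=> D_gt0 le_dD; have leN := leq_addr D N.
have [M defM] : exists M, (N + D = M.+1)%N by exists (N + D).-1; lia.
move: leN; rewrite defM => leN.
pose f := widen_ord leN : 'I_N -> 'I_M.+1.
have f_inj : injective f by move=> x x' /(congr1 val) /= /val_inj.
pose c (i : 'I_d) : 'I_M.+1 := inZp (i * D).
have c_small (i : 'I_d) r : (r < D -> i * D + r < M.+1)%N.
  by move=> r_lt; have := ltn_ord i; rewrite -defM; nia.
have c_inj : injective c.
  move=> i k /(congr1 val) /=; have := c_small i 0; have := c_small k 0.
  rewrite !addn0 => kM iM; rewrite !modn_small ?kM ?iM // => /eqP.
  by rewrite eqn_pmul2r // => /eqP/val_inj.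
pose C := [set c i | i in 'I_d].
have cC : #|C| = d by rewrite card_imset // card_ord.
exists (diff_adj f C); split=> [x | y]; first by rewrite card_diff_adjr cC.
rewrite -cC card_diff_adjl_le //=.
apply: card_diff_adjl_ge => // _ _ /imsetP[i _ ->] /imsetP[k _ ->].
have missE (z : 'I_M.+1) : z \notin codom f -> (N <= z)%N.
  apply: contraR; rewrite -ltnNge => zN; apply/codomP.
  by exists (Ordinal zN); apply: val_inj.
move=> /missE zi /missE zk; congr c; apply: val_inj => /=.
have: c i + (y - c i) = c k + (y - c k) by rewrite !subrKC.
move: zi zk; move: (y - c i) (y - c k) => [z zM] [z' zM'] /= Nz Nz'.
move/(congr1 val) => /= /eqP.
(* Subtracting N from both sides leaves iD + r = kD + r' modulo N + D with r and
   r' less than D; both sides are small, so i = k by dividing by D. *)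
rewrite !modnDml -(subnK Nz) -(subnK Nz') !addnA eqn_modDr.
rewrite !modn_small ?c_small; try lia.
move=> /eqP /(congr1 (divn^~ D)); rewrite !divnMDl // !divn_small ?addn0 //; lia.
Qed.

(** Suppose that i differs from k and l.  If the largest exponent occurs on one
    side only, its power alone bounds the sum on the other side, so the sums
    differ.  Otherwise n is k or l, and cancelling gives i = l or i = k. *)
Lemma pow2_sidon i k l n :
  (2 ^ i + 2 ^ n = 2 ^ k + 2 ^ l -> i = k \/ i = l)%N.
Proof.
have pow_gt0 p : (0 < 2 ^ p)%N by rewrite expn_gt0.
have double p q : (p < q -> 2 ^ p + 2 ^ p <= 2 ^ q)%N.
  by move=> pq; rewrite addnn -mul2n -expnS leq_exp2l.
have mono p q : (p <= q -> 2 ^ p <= 2 ^ q)%N by move=> pq; rewrite leq_exp2l.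
move: (pow_gt0 i) (pow_gt0 k) (pow_gt0 l) (pow_gt0 n).
move: (double i k) (double i l) (double n k) (double n l).
move: (double k i) (double k n) (double l i) (double l n).
move: (mono k n) (mono n k) (mono l n) (mono n l).
lia.
Qed.

(** The shifts are the powers 2^i with i < d.  Sums of two of them are at most
    2^d < M, so the Sidon property of the powers of 2 survives modulo M. *)
Lemma C4_free_bipartite d N M : (N <= M)%N -> (2 ^ d < M)%N ->
  exists h : 'I_N -> 'I_M -> bool,
    (forall x, #|[set y | h x y]| = d) /\
    (forall x x' y y', h x y -> h x y' -> h x' y -> h x' y' -> x = x' \/ y = y').
Proof.
case: M => // M leN ltM.
pose f := widen_ord leN : 'I_N -> 'I_M.+1.
have f_inj : injective f by move=> x x' /(congr1 val) /= /val_inj.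
pose c (i : 'I_d) : 'I_M.+1 := inZp (2 ^ i).
have c_small (i k : 'I_d) : (2 ^ i + 2 ^ k < M.+1)%N.
  apply: leq_ltn_trans ltM; have [id kd] := (ltn_ord i, ltn_ord k).
  apply: leq_trans (_ : 2 ^ d.-1.+1 <= _)%N; last by rewrite leq_exp2l //; lia.
  by rewrite expnS mul2n -addnn leq_add // leq_exp2l //; lia.
have val_c i : val (c i) = (2 ^ i)%N.
  by rewrite /= modn_small //; have := c_small i i; lia.
have c_inj : injective c.
  move=> i k /(congr1 val); rewrite !val_c => /eqP.
  by rewrite eqn_exp2l // => /eqP/val_inj.
pose C := [set c i | i in 'I_d].
exists (diff_adj f C); split=> [x|].
  by rewrite card_diff_adjr card_imset // card_ord.
apply: diff_adj_C4_free => // _ _ /imsetP[i _ ->] /imsetP[k _ ->] _ _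
  /imsetP[l _ ->] /imsetP[n _ ->] /(congr1 val) /=.
rewrite !modnDm !modn_small ?c_small // => /pow2_sidon[] /val_inj ->; by [left | right].
Qed.

(** * Gluing two sparse graphs along complete ones *)

Section Gluing.
Variables (U0 U1 V0 V1 : finType).
Variables (h0 : U0 -> V0 -> bool) (h1 : V1 -> U1 -> bool).

Definition cross_adj (u : U0 + U1) (v : V0 + V1) : bool :=
  match u, v with
  | inl u, inl v => h0 u v
  | inr u, inr v => h1 v u
  | _, _ => true
  end.

Definition glue : rel ((U0 + U1) + (V0 + V1)) := fun x y =>
  match x, y with
  | inl u, inr v | inr v, inl u => cross_adj u v
  | _, _ => false
  end.

Definition glueU : {set (U0 + U1) + (V0 + V1)} :=
  [set x | if x is inl _ then true else false].
Definition glueV : {set (U0 + U1) + (V0 + V1)} :=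
  [set x | if x is inr _ then true else false].
Definition glueU0 : {set (U0 + U1) + (V0 + V1)} :=
  [set x | if x is inl (inl _) then true else false].
Definition glueV0 : {set (U0 + U1) + (V0 + V1)} :=
  [set x | if x is inr (inl _) then true else false].

Lemma card_set_sum (A B : finType) (P : pred (A + B)) :
  #|[set x | P x]| = (#|[set a | P (inl a)]| + #|[set b | P (inr b)]|)%N.
Proof. by rewrite -!sum1dep_card big_sumType. Qed.

Lemma card_set_bool (A : finType) (b : bool) :
  #|[set _ : A | b]| = if b then #|A| else 0%N.
Proof. by rewrite cardsE; case: b; [exact: eq_card | exact: card0]. Qed.

Let cardE := (card_set_sum, card_set_bool).

Lemma glue_sym : symmetric glue.
Proof. by case=> x [] y. Qed.

Lemma glue_bipartition : bipartition glue glueU glueV.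
Proof.
split.
- by apply/setP => -[] x; rewrite !inE.
- by rewrite -setI_eq0; apply/eqP/setP => -[] x; rewrite !inE.
- by case=> x [] y; rewrite ?inE.
Qed.

Lemma card_glueU : #|glueU| = (#|U0| + #|U1|)%N.
Proof. by rewrite /glueU !cardE /= !addn0. Qed.

Lemma card_glueV : #|glueV| = (#|V0| + #|V1|)%N.
Proof. by rewrite /glueV !cardE. Qed.

Lemma card_glueU0 : #|glueU0| = #|U0|.
Proof. by rewrite /glueU0 !cardE /= !addn0. Qed.

Lemma card_glueV1 : #|glueV :\: glueV0| = #|V1|.
Proof.
rewrite -(card_imset predT (inj_comp (@inr_inj (U0 + U1) _) (@inr_inj V0 V1))).
apply: eq_card => x; apply/idP/imsetP => [|[v _ ->]]; last by rewrite !inE.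
by case: x => [|[]] x; rewrite !inE // => _; exists x.
Qed.

Lemma deg_glueU0 u : deg glue (inl (inl u)) = (#|[set v | h0 u v]| + #|V1|)%N.
Proof. by rewrite /deg !cardE. Qed.

Lemma deg_glueU1 u : deg glue (inl (inr u)) = (#|V0| + #|[set v | h1 v u]|)%N.
Proof. by rewrite /deg !cardE. Qed.

Lemma deg_glueV0 v : deg glue (inr (inl v)) = (#|[set u | h0 u v]| + #|U1|)%N.
Proof. by rewrite /deg !cardE /= !addn0. Qed.

Lemma deg_glueV1 v : deg glue (inr (inr v)) = (#|U0| + #|[set u | h1 v u]|)%N.
Proof. by rewrite /deg !cardE /= !addn0. Qed.

Lemma glue_no_Kss_tiling s m :
    (0 < s)%N -> (#|U0| + #|U1| = m * s)%N ->
    (forall u, #|[set v | h0 u v]| + 2 <= s)%N ->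
    (forall v, #|[set u | h0 u v]| + 2 <= s)%N ->
    (forall x x' y y', h1 x y -> h1 x y' -> h1 x' y -> h1 x' y' -> x = x' \/ y = y') ->
    (forall k, ~~ (#|U0| <= k * s <= #|V1|)%N) ->
  ~ Kss_tiling glue s m.
Proof.
move=> s_gt0 cU degU degV C4 no_multiple.
apply: (@no_Kss_tiling _ glue glueU glueV glue_sym glue_bipartition glueU0 glueV0) => //.
- case=> [[u|u]|v]; rewrite inE // => _; apply: leq_trans (degU u).
  rewrite leq_add2r -(card_imset _ (inj_comp (@inr_inj (U0 + U1) _) (@inl_inj V0 V1))).
  apply/subset_leq_card/subsetP; case=> [|[]] v; rewrite !inE // => uv.
  by apply/imsetP; exists v; rewrite ?inE.
- case=> [u|[v|v]]; rewrite inE // => _; apply: leq_trans (degV v).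
  rewrite leq_add2r -(card_imset _ (inj_comp (@inl_inj _ (V0 + V1)) (@inl_inj U0 U1))).
  apply/subset_leq_card/subsetP; case=> [[]|] u; rewrite !inE // => uv.
  by apply/imsetP; exists u; rewrite ?inE.
- case=> [[]|] x; case=> [[]|] x'; case=> [|[]] y; case=> [|[]] y';
    rewrite !inE //= => _ _ _ _ xy xy' x'y x'y'.
  by case: (C4 _ _ _ _ xy x'y xy' x'y') => ->; [right | left].
- by apply/subsetP; case=> [[]|] x; rewrite !inE.
- by rewrite card_glueU.
- by move=> k; rewrite card_glueU0 card_glueV1.
Qed.

End Gluing.

(** * The construction *)

Lemma min_degE (T : finType) (e : rel T) (U : {set T}) u k :
  u \in U -> deg e u = k -> {in U, forall x, (k <= deg e x)%N} -> min_deg e U = k.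
Proof.
move=> uU degu le_k; apply/eqP; rewrite eqn_leq; apply/andP; split.
  rewrite /min_deg -degu; have: u \in index_enum T by rewrite mem_index_enum.
  elim: (index_enum T) => // x r IHr; rewrite in_cons big_cons.
  case/predU1P => [<-|/IHr le_r]; first by rewrite uU geq_minl.
  by case: ifP => // _; apply: leq_trans (geq_minr _ _) le_r.
rewrite /min_deg; elim/big_rec: _ => [|x r xU le_r]; first by rewrite -degu max_card.
by rewrite leq_min le_k.
Qed.

Theorem proposition1p10 (s : nat) (hs : (2 <= s)%N) (j : nat) (hj : (0 < j)%N) :
  exists (m n : nat) (T : finType) (e : rel T) (U V : {set T}),
    n = (m * s)%N /\
    #|T| = (2 * n)%N /\
    balanced_bipartite e U V /\
    (min_deg e U)%:Z + (min_deg e V)%:Z = n%:Z + 3 * s%:Z - 7 /\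
    2 * s%:Z * j%:Z - s%:Z - 1 <= `|(min_deg e V)%:Z - (min_deg e U)%:Z| /\
    `|(min_deg e V)%:Z - (min_deg e U)%:Z| <= 2 * s%:Z * j%:Z - 1 /\
    ~ Kss_tiling e s m.
Proof.
(* The number D is the excess of |V0| over |U0|, d the degree in the 4-cycle-free
   graph, and w a multiple of s large enough for both sparse graphs. *)
pose D := (2 * j * s)%N.
have D_ge : (2 * s <= D)%N by rewrite /D; nia.
pose d := (D + 2 * s - 5)%N.
pose w := ((2 ^ d + D * s) * s)%N.
have w_ge : (2 ^ d + D * s <= w)%N by rewrite /w leq_pmulr //; lia.
have [||h0 [degU0 degV0]] := @near_regular_bipartite (s - 2) D (w + 1);
  [lia | nia |].
have [||h1 [degV1 C4]] := @C4_free_bipartite d (w + s - 1) (w + s + D - 1);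
  [lia | nia |].
pose m := (2 * (2 ^ d + D * s) + 1 + 2 * j)%N.
have nE : (m * s = 2 * w + s + D)%N by rewrite /m /w /D; lia.
exists m, (m * s)%N, _, (glue h0 h1), (glueU _ _ _ _), (glueV _ _ _ _).
have -> : min_deg (glue h0 h1) (glueU _ _ _ _) = (w + 2 * s - 3)%N.
  have x0 : 'I_(w + 1) by rewrite addn1; exact: ord0.
  apply: (@min_degE _ _ _ (inl (inl x0))); first by rewrite inE.
    by rewrite deg_glueU0 degU0 card_ord; lia.
  case=> [[u|u]|v]; rewrite inE // => _.
    by rewrite deg_glueU0 degU0 card_ord; lia.
  by rewrite deg_glueU1 card_ord; lia.
have -> : min_deg (glue h0 h1) (glueV _ _ _ _) = (w + 1 + d)%N.
  have x0 : 'I_(w + s - 1).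
    by apply: (@Ordinal _ 0); lia.
  apply: (@min_degE _ _ _ (inr (inr x0))); first by rewrite inE.
    by rewrite deg_glueV1 degV1 card_ord.
  case=> [u|[v|v]]; rewrite inE // => _.
    by rewrite deg_glueV0 card_ord; have /andP[_] := degV0 v; lia.
  by rewrite deg_glueV1 degV1 card_ord.
split=> //; split; first by rewrite !card_sum !card_ord; lia.
split.
  split; last by rewrite card_glueU card_glueV !card_ord; lia.
    by split; [exact: glue_sym | case].
  exact: glue_bipartition.
split; first by rewrite nE; lia.
split; first by rewrite /d /D; lia.
split; first by rewrite /d /D; lia.
apply: glue_no_Kss_tiling => //.
- lia.
- by rewrite !card_ord; lia.
- by move=> u; rewrite degU0; lia.
- by move=> v; have /andP[+ _] := degV0 v; lia.
- move=> k; rewrite !card_ord; apply/negP => /andP[].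
  rewrite /w addn1 ltn_pmul2r; last lia.
  (* No multiple of s lies between w + 1 and w + s - 1. *)
  move=> lt_k le_k.
  have : ((2 ^ d + D * s).+1 * s <= k * s)%N by rewrite leq_mul2r lt_k orbT.
  by rewrite mulSn; lia.
Qed.
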